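(* Let $(G,d)$ be a metric space, $\mathcal A$ the $\sigma$-algebra of all measurable subsets of $G$, and $\mu:\mathcal A\to[0,+\infty]$ a $\sigma$-finite regular measure. Then a function $f:G\to\mathbb R$ is integrable (in the sense defined in the context) if and only if it is Lebesgue integrable with respect to $\mu$, and in this case $$\int_A f(g)\,d\mu(g)=(L)\int_A f(g)\,d\mu(g)\qquad\text{for all }A\in\mathcal A,$$ where $(L)\int$ denotes the Lebesgue integral with respect to $\mu$.
   Context: ''Measurable'' means $\mu$-measurable; in particular $\mathcal A$ contains the Borel sets of $G$ and is complete with respect to $\mu$. $\mu$ is regular if $\mu(C)<+\infty$ for every compact $C\subset G$, and for every $\varepsilon>0$ and $E\in\mathcal A$ there are a compact set $C\subset E$ and an open set $U\supset E$ with $\mu(U\setminus C)\le\varepsilon$. $\sigma$-finite means $G=\bigcup_nB_n$ with $B_n\in\mathcal A$, $\mu(B_n)<+\infty$. The integral of the paper is here taken with $\mathbf X=\mathbf X_1=\mathbf X_2=\mathbb R$, all endowed with the usual convergence of real sequences and the usual limit superior. It is defined as follows. A simple function is $f=\sum_{j=1}^rc_j\chi_{A_j}$ with $c_j\in\mathbb R$, $A_j\in\mathcal A$, $\mu(A_j)<+\infty$, and $\int_Af\,d\mu=\sum_jc_j\,\mu(A\cap A_j)$. A sequence $(f_n)_n$ of real functions on $G$ converges in $\mu$-measure to $f$ on $A\in\mathcal A$ if there are $A_n\in\mathcal A$ with $\mu(A\cap A_n)\to0$ and $\sup_{g\in A\setminus A_n}|f_n(g)-f(g)|\to0$ (supremum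 over the empty set being $0$). The integrals of a sequence $(f_n)_n$ of simple functions are $\mu$-equiabsolutely continuous if (i) $\int_{A_n}|f_n|\,d\mu\to0$ for every sequence $(A_n)_n$ in $\mathcal A$ with $\mu(A_n)\to0$, and (ii) there is an increasing sequence $(B_m)_m$ in $\mathcal A$ with $\mu(B_m)<+\infty$ for all $m$ and $\lim_m\limsup_n\int_{G\setminus B_m}|f_n|\,d\mu=0$. A sequence of simple functions is defining for $f$ if it converges in $\mu$-measure to $f$ on every $A\in\mathcal A$ with $\mu(A)<+\infty$ and its integrals are $\mu$-equiabsolutely continuous. A function $f\ge0$ is integrable if there are a defining sequence $(f_n)_n$ for $f$ and a map $l:\mathcal A\to\mathbb R$ with $\sup_{A\in\mathcal A}|\int_Af_n\,d\mu-l(A)|\to0$; then $\int_Af\,d\mu:=l(A)$ (this is independent of choices). A general $f:G\to\mathbb R$ is integrable if $f^+$ and $f^-$ are, and $\int_Af\,d\mu=\int_Af^+\,d\mu-\int_Af^-\,d\mu$. *)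

(* Defs.v *)
From HB Require Import structures.
From mathcomp Require Import all_boot all_order all_algebra.
From mathcomp Require Import all_classical all_reals all_analysis.
From mathcomp Require Import measurable_realfun.
Set Implicit Arguments.
Unset Strict Implicit.
Unset Printing Implicit Defensive.
Import Order.TTheory GRing.Theory Num.Theory.
Import numFieldNormedType.Exports.
Local Open Scope classical_set_scope.
Local Open Scope ring_scope.

(* A metric space carrying a sigma-algebra. The structure itself imposes no
   relation between the two: that open sets are measurable is a separate
   hypothesis. *)
#[short(type="measurableMetricType")]
HB.structure Definition MeasurableMetric (d : measure_display) (R : realType) :=
  {T of Measurable d T & Metric R T}.

(* The second condition ranges over all measurable sets, not only those of
   finite measure. *)
Definition regular_measure (d : measure_display) (R : realType)
    (G : measurableMetricType d R) (mu : set G -> \bar R) : Prop :=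
  (forall C : set G, compact C -> (mu C < +oo)%E) /\
  (forall (e : R) (E : set G), 0 < e -> measurable E ->
    exists C U : set G, [/\ compact C, C `<=` E, open U, E `<=` U
                          & (mu (U `\` C) <= e%:E)%E]).

Section vitali_integral.
Context (d : measure_display) (R : realType) (G : measurableType d).
Variable mu : set G -> \bar R.
Implicit Types (f : G -> R) (A : set G) (fs : nat -> G -> R).

Definition simple_rep f (r : nat) (c : 'I_r -> R) (B : 'I_r -> set G) : Prop :=
  (forall j, measurable (B j) /\ (mu (B j) < +oo)%E) /\
  (forall x, f x = \sum_(j < r) c j * \1_(B j) x).

Definition simple_function f : Prop :=
  exists (r : nat) (c : 'I_r -> R) (B : 'I_r -> set G), simple_rep f c B.

(* The value does not depend on the representation: see simple_integralE. *)
Definition simple_integral A f : R :=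
  get [set v | exists (r : nat) (c : 'I_r -> R) (B : 'I_r -> set G),
    simple_rep f c B /\ v = \sum_(j < r) c j * fine (mu (A `&` B j))].

(* Adjoining 0 makes the supremum over the empty set 0 instead of -oo. *)
Definition cvg_in_measure_on A fs f : Prop :=
  exists A_ : nat -> set G, [/\ forall n, measurable (A_ n),
    mu (A `&` A_ n) @[n --> \oo] --> 0%E &
    ereal_sup (0%E |` [set (`|fs n g - f g|)%:E | g in A `\` A_ n])
      @[n --> \oo] --> 0%E].

Definition equi_abs_continuous fs : Prop :=
  (forall A_ : nat -> set G, (forall n, measurable (A_ n)) ->
     mu (A_ n) @[n --> \oo] --> 0%E ->
     simple_integral (A_ n) (fun g => `|fs n g|) @[n --> \oo] --> 0) /\
  (exists B : nat -> set G,
     [/\ forall m, measurable (B m) /\ (mu (B m) < +oo)%E,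
         {homo B : m n / (m <= n)%N >-> m `<=` n} &
         limn_esup (fun n =>
             (simple_integral (~` B m) (fun g => `|fs n g|))%:E)
           @[m --> \oo] --> 0%E]).

Definition defining_sequence fs f : Prop :=
  [/\ forall n, simple_function (fs n),
      forall A, measurable A -> (mu A < +oo)%E -> cvg_in_measure_on A fs f &
      equi_abs_continuous fs].

(* Only the values of l on measurable sets matter. *)
Definition integrals_cvg_unif fs (l : set G -> R) : Prop :=
  ereal_sup [set (`|simple_integral A (fs n) - l A|)%:E | A in measurable]
    @[n --> \oo] --> 0%E.

Definition nonneg_vitali_integrable f : Prop :=
  (forall g, 0 <= f g) /\
  exists fs (l : set G -> R), defining_sequence fs f /\ integrals_cvg_unif fs l.

Definition nonneg_vitali_integral A f : R :=
  get [set v | exists fs (l : set G -> R),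
    [/\ defining_sequence fs f, integrals_cvg_unif fs l & v = l A]].

Definition vitali_integrable f : Prop :=
  nonneg_vitali_integrable f^\+ /\ nonneg_vitali_integrable f^\-.

Definition vitali_integral A f : R :=
  nonneg_vitali_integral A f^\+ - nonneg_vitali_integral A f^\-.

End vitali_integral.

Section simple_integralE.
Context (d : measure_display) (R : realType) (G : measurableType d).
Variable mu : {measure set G -> \bar R}.

Let simple_rep_integral A f r (c : 'I_r -> R) B : measurable A ->
  simple_rep mu f c B ->
  (\sum_(j < r) c j * fine (mu (A `&` B j)))%:E = (\int[mu]_(x in A) (f x)%:E)%E.
Proof.
move=> mA [mB fE].
under eq_integral do rewrite fE -sumEFin.
have fin j : (mu (A `&` B j) < +oo)%E.
  apply: le_lt_trans (mB j).2; apply: le_measure; rewrite ?inE.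
  - by apply: measurableI => //; exact: (mB j).1.
  - exact: (mB j).1.
  - exact: subIsetr.
have fn j : mu (A `&` B j) \is a fin_num by rewrite ge0_fin_numE.
have intB j : mu.-integrable A (EFin \o (\1_(B j) : G -> R)).
  apply/integrableP; split.
    exact/measurable_EFinP/measurable_indic/(mB j).1.
  under eq_integral do rewrite /= ger0_norm//.
  by rewrite integral_indic//; [rewrite setIC; exact: fin|exact: (mB j).1].
rewrite (integral_sum mA (f := fun j x => (c j * \1_(B j) x)%:E)); last first.
  move=> j; under eq_fun do rewrite EFinM.
  exact: integrableZl (intB j).
rewrite -sumEFin; apply: eq_bigr => j _.
under eq_integral do rewrite EFinM.
rewrite integralZl//; last exact: intB.
by rewrite integral_indic//; [rewrite EFinM fineK// setIC|exact: (mB j).1].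
Qed.

Lemma simple_integralE A f r (c : 'I_r -> R) B : measurable A ->
  simple_rep mu f c B ->
  simple_integral mu A f = \sum_(j < r) c j * fine (mu (A `&` B j)).
Proof.
move=> mA fcB; apply: EFin_inj; rewrite (simple_rep_integral mA fcB).
rewrite /simple_integral; case: xgetP => [v _ /= [r' [c' [B' [fcB' ->]]]]|].
  exact: simple_rep_integral mA fcB'.
by move=> /(_ (\sum_(j < r) c j * fine (mu (A `&` B j)))) []; exists r, c, B.
Qed.

End simple_integralE.

(* Main.v *)
(* If [fs] is defining for [f >= 0] and its integrals converge uniformly over
   measurable sets, then testing on {fs n - fs m >= 0} and its complement shows
   that [fs] is Cauchy in L1. By sigma-finiteness and Borel-Cantelli a
   subsequence converges a.e. to [f], so [f] is measurable by completeness, and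
   Fatou's lemma upgrades this to L1-convergence of [fs] to [f].
   Conversely, if [f >= 0] is Lebesgue integrable, rounding [f] down to
   multiples of 1/n and truncating at n gives simple functions below [f] that
   converge to it in L1 by dominated convergence. They are within 1/n of [f]
   where [f < n], a set whose complement has measure O(1/n) by Markov's
   inequality, and equiabsolute continuity follows from that of the integral of
   [f]. *)
Require Import Defs.
From HB Require Import structures.
From mathcomp Require Import all_boot all_order all_algebra.
From mathcomp Require Import all_classical all_reals all_analysis.
From mathcomp Require Import measurable_realfun.
From mathcomp Require Import ring zify.
Set Implicit Arguments.
Unset Strict Implicit.
Unset Printing Implicit Defensive.
Import Order.TTheory GRing.Theory Num.Theory.
Import numFieldNormedType.Exports.
Local Open Scope classical_set_scope.
Local Open Scope ring_scope.

(** * Null sequences of extended reals *)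

Section ereal_cvg0.
Context (R : realType).
Implicit Types u v : nat -> \bar R.

Lemma cvge0_near_lt u (e : R) : u n @[n --> \oo] --> 0%E -> 0 < e ->
  \forall n \near \oo, (u n < e%:E)%E.
Proof.
move=> u0 e0; apply: (u0 [set y | (y < e%:E)%E]).
by apply: open_ereal_lt'; rewrite lte_fin.
Qed.

Lemma cvge0_squeeze u v : (forall n, 0 <= u n <= v n)%E ->
  v n @[n --> \oo] --> 0%E -> u n @[n --> \oo] --> 0%E.
Proof.
move=> uv v0; apply: (squeeze_cvge (f := cst 0%E) _ _ v0); last exact: cvg_cst.
by apply: nearW => n; exact: uv.
Qed.

Lemma cvge0_near_le u : (forall n, 0 <= u n)%E ->
  (forall e : R, 0 < e -> \forall n \near \oo, (u n <= e%:E)%E) ->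
  u n @[n --> \oo] --> 0%E.
Proof.
(* For nonnegative terms a limit superior at most 0 already forces convergence to 0. *)
move=> u0 ue; apply: limn_esup_le_cvg => //.
apply/lee_addgt0Pr => e e0; rewrite add0e limn_esup_lim.
have [N _ uN] := ue _ e0.
apply: lime_le; first exact: is_cvg_esups.
exists N => // n /= Nn; apply: ge_ereal_sup => _ [m /= nm <-].
by apply: uN => /=; exact: leq_trans nm.
Qed.

End ereal_cvg0.

(** * Simple integrals as Lebesgue integrals *)

Section simple_function_lebesgue.
Context (d : measure_display) (R : realType) (G : measurableType d).
Variable mu : {measure set G -> \bar R}.
Implicit Types f : G -> R.

Let integrable_term (c : R) (B : set G) : measurable B -> (mu B < +oo)%E ->
  mu.-integrable setT (fun x => c%:E * (\1_B x)%:E)%E.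
Proof.
move=> mB Boo; apply: integrableZl => //; apply/integrableP; split.
  exact/measurable_EFinP/measurable_indic.
under eq_integral do rewrite /= ger0_norm//.
by rewrite integral_indic// setIT.
Qed.

Let simple_repE f r (c : 'I_r -> R) B : simple_rep mu f c B ->
  EFin \o f = (fun x => \sum_(j < r) (c j)%:E * (\1_(B j) x)%:E)%E.
Proof.
move=> [_ fE]; apply/funext => x /=.
by rewrite fE -sumEFin; apply: eq_bigr => j _; rewrite EFinM.
Qed.

Lemma simple_function_integrable f :
  simple_function mu f -> mu.-integrable setT (EFin \o f).
Proof.
move=> [r [c [B fcB]]]; rewrite (simple_repE fcB); apply: integrable_sum => // j _.
by have [mB Boo] := fcB.1 j; exact: integrable_term.
Qed.

Lemma simple_integral_lebesgue A f : measurable A -> simple_function mu f ->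
  (simple_integral mu A f)%:E = (\int[mu]_(x in A) (f x)%:E)%E.
Proof.
move=> mA [r [c [B fcB]]]; rewrite (simple_integralE mA fcB).
rewrite -/(EFin \o f) (simple_repE fcB) integral_sum//; last first.
  move=> j; have [mB Boo] := fcB.1 j.
  exact: integrableS (integrable_term _ mB Boo).
rewrite -sumEFin; apply: eq_bigr => j _; have [mB Boo] := fcB.1 j.
rewrite integralZl//; last first.
  have := integrableS measurableT mA (@subsetT _ _) (integrable_term 1 mB Boo).
  by under eq_fun do rewrite mul1e.
have ABfin : mu (A `&` B j) \is a fin_num.
  rewrite ge0_fin_numE//; apply: le_lt_trans Boo.
  by apply: le_measure; rewrite ?inE//; exact: measurableI.
by rewrite integral_indic// EFinM fineK// setIC.
Qed.

End simple_function_lebesgue.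

(** * From convergence in measure to almost everywhere convergence of a subsequence *)

Section cvg_in_measure.
Context (d : measure_display) (R : realType) (G : measurableType d).
Variable mu : {measure set G -> \bar R}.
Implicit Types (f : G -> R) (fs : nat -> G -> R).

Lemma cvg_in_measure_on_exists A fs f (e : R) (k : nat) : 0 < e ->
  measurable A -> cvg_in_measure_on mu A fs f ->
  exists n (E : set G), [/\ (k <= n)%N, measurable E, (mu E <= e%:E)%E &
    forall x, A x -> ~ E x -> `|fs n x - f x| <= e].
Proof.
move=> e0 mA [A_ [mA_ muA_ supA_]].
near \oo => n; exists n, (A `&` A_ n); split.
- by near: n; exact: nbhs_infty_ge.
- exact: measurableI.
- by apply/ltW; near: n; exact: (cvge0_near_lt muA_ e0).
- have supn : (ereal_sup
      (0 |` [set (`|fs n g - f g|)%:E | g in A `\` A_ n]) < e%:E)%E.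
    by near: n; exact: (cvge0_near_lt supA_ e0).
  move=> x Ax nEx; rewrite -lee_fin; apply: le_trans (ltW supn).
  apply: ereal_sup_ubound; right; exists x => //; split=> // Anx.
  exact: nEx.
Unshelve. all: by end_near. Qed.

(** Take an increasing exhaustion [F] by sets of finite measure and choose [phi k] so that
    [fs (phi k)] is within [e k] of [f] on [F k] off a set [E k] of measure at most [e k]. The [e k]
    are summable, so Borel-Cantelli makes the limit superior of the [E k] null. *)
Lemma cvg_in_measure_subseq_ae fs f : sigma_finite setT mu ->
  (forall A, measurable A -> (mu A < +oo)%E -> cvg_in_measure_on mu A fs f) ->
  exists phi : nat -> nat, (forall k, (k <= phi k)%N) /\
    {ae mu, forall x, fs (phi k) x @[k --> \oo] --> f x}.
Proof.
move=> /sigma_finiteP[F [UF ndF mF]] cvgf.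
pose e k : R := 1 / (2 ^ (k + 1))%:R.
have e0 k : 0 < e k by rewrite divr_gt0// ltr0n expn_gt0.
have /choice[phi /choice[E phiE]] k :=
  cvg_in_measure_on_exists k (e0 k) (mF k).1 (cvgf _ (mF k).1 (mF k).2).
exists phi; split; first by move=> k; have [] := phiE k.
have mE k : measurable (E k) by have [] := phiE k.
exists (lim_sup_set E); split.
- by apply: bigcap_measurable => // k _; exact: bigcup_measurable.
- apply: lim_sup_set_cvg0 => //.
  apply: (@le_lt_trans _ _ (\sum_(0 <= k <oo) (e k)%:E)%E).
    by apply: lee_nneseries => // k _; have [] := phiE k.
  have /cvg_lim : (eseries (fun k => (e k)%:E) n @[n --> \oo] --> (1 : R)%:E)%E.
    by have := @cvg_geometric_eseries_half R 1 0; rewrite expr0 divr1.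
  by rewrite /eseries/= => ->//; rewrite ltry.
(* A point lying in no [E n] with [n] at least [k] is a point of convergence: it belongs to some
   [F m], hence to every later [F n], where the error is at most [e n]. *)
- move=> x /= ncvg k _; apply: contrapT => nEx; apply: ncvg.
  have [m _ Fmx] : (\bigcup_i F i) x by rewrite -UF.
  apply/cvgrPdist_le => eps eps0.
  have e_cvg0 : e n @[n --> \oo] --> (0 : R).
    have := @cvg_geometric R 1 (2^-1).
    rewrite ger0_norm ?invr_ge0// invf_lt1// ltr1n => /(_ isT).
    rewrite -(cvg_shiftn 1); apply: cvg_trans.
    by apply: near_eq_cvg; apply: nearW => n; rewrite /e /geometric/= natrX exprVn.
  near=> n; have [_ _ _ /(_ x) fE] := phiE n.
  rewrite distrC; apply: le_trans (fE _ _) _.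
  + apply: (subsetPset _ _ (ndF m n _)) => //; by near: n; exact: nbhs_infty_ge.
  + move=> Enx; apply: nEx; exists n => //=; by near: n; exact: nbhs_infty_ge.
  + apply/ltW; near: n; exact: (cvgr_lt _ e_cvg0).
Unshelve. all: by end_near. Qed.

End cvg_in_measure.

(** * Integrable functions are Lebesgue integrable *)

Section lebesgue_of_vitali.
Context (d : measure_display) (R : realType) (G : measurableType d).
Variable mu : {measure set G -> \bar R}.
Implicit Types (f h : G -> R) (fs : nat -> G -> R) (l : set G -> R).

(** On [P], where [h] is nonnegative, and on its complement, the integral of the absolute value is
    plus or minus that of [h]; each half contributes at most [M]. *)
Lemma integral_abs_le_sup h (M : R) : mu.-integrable setT (EFin \o h) ->
  (forall A, measurable A -> `|\int[mu]_(x in A) (h x)%:E| <= M%:E)%E ->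
  (\int[mu]_x (`|h x|)%:E <= (2 * M)%:E)%E.
Proof.
move=> ih hM; pose P := [set x | 0 <= h x].
have mh : measurable_fun setT h by apply/measurable_EFinP; exact: measurable_int ih.
have mP : measurable P.
  rewrite (_ : P = h @^-1` `[0, +oo[); last first.
    by apply/seteqP; split=> x; rewrite /P /= in_itv/= andbT.
  by rewrite -[X in measurable X]setTI; exact: mh.
have mC := measurableC mP.
rewrite -(setUv P) ge0_integral_setU//; last 2 first.
  - by rewrite setUv; apply/measurable_EFinP; exact: measurableT_comp.
  - by apply/disj_setPS; rewrite setICr.
rewrite mulr_natl mulr2n EFinD; apply: leeD.
- rewrite (eq_integral (fun x => (h x)%:E)); last first.
    by move=> x; rewrite inE => Px; rewrite ger0_norm.
  exact: le_trans (lee_abs _) (hM _ mP).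
- rewrite (eq_integral (fun x => - (h x)%:E)%E); last first.
    by move=> x; rewrite inE /P/= => /negP; rewrite -ltNge => /ltr0_norm ->.
  rewrite (_ : (\int[mu]_(x in ~` P) - (h x)%:E =
                - \int[mu]_(x in ~` P) (h x)%:E)%E); last first.
    under eq_integral do rewrite -mulN1e -EFinN.
    rewrite integralZl//; first by rewrite EFinN mulN1e.
    exact: integrableS ih.
  by apply: le_trans (lee_abs _) _; rewrite abseN; exact: hM.
Qed.

Lemma integrals_cvg_unif_near fs l (e : R) :
  (forall n, simple_function mu (fs n)) -> integrals_cvg_unif mu fs l -> 0 < e ->
  \forall n \near \oo, forall A, measurable A ->
    (`|\int[mu]_(x in A) (fs n x)%:E - (l A)%:E| <= e%:E)%E.
Proof.
move=> sfs cvgl e0; have := cvge0_near_lt cvgl e0.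
apply: filterS => n /ltW supe A mA.
rewrite -simple_integral_lebesgue// -EFinB abse_EFin.
by apply: le_trans supe; apply: ereal_sup_ubound; exists A.
Qed.

(** Fatou's lemma applied to the distances from a fixed [h]; with [h] a term of the sequence it
    turns a Cauchy estimate into a distance to the limit. *)
Lemma fatou_abs_le fs f h (e : R) : measurable_fun setT f ->
  (forall n, measurable_fun setT (fs n)) -> measurable_fun setT h ->
  {ae mu, forall x, fs n x @[n --> \oo] --> f x} ->
  (\forall n \near \oo, (\int[mu]_x (`|h x - fs n x|)%:E <= e%:E)%E) ->
  (\int[mu]_x (`|h x - f x|)%:E <= e%:E)%E.
Proof.
move=> mf mfs mh fsf [N _ fse].
have mabs (g : G -> R) : measurable_fun setT g ->
    measurable_fun setT (fun x => (`|h x - g x|)%:E).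
  move=> mg; apply/measurable_EFinP; apply: measurableT_comp => //.
  exact: measurable_funB.
rewrite (ae_eq_integral (fun x => limn_einf (fun n => (`|h x - fs n x|)%:E)))//.
- apply: le_trans (fatou mu measurableT _ _) _ => //.
  + by move=> n; exact: mabs.
  + rewrite limn_einf_lim; apply: lime_le; first exact: is_cvg_einfs.
    exists N => // n /= Nn; apply: le_trans (fse n Nn).
    by apply: ereal_inf_lbound; exists n => /=.
- exact: mabs.
- apply: (emeasurable_fun_cvg (fun n x => einfs (fun n => (`|h x - fs n x|)%:E) n)).
    by apply: measurable_fun_einfs => n; exact: mabs.
  by move=> x _; rewrite limn_einf_lim; exact: is_cvg_einfs.
- apply: filterS fsf => x fsx _.
  have cvgx : (`|h x - fs n x|)%:E @[n --> \oo] --> (`|h x - f x|)%:E.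
    apply: cvg_EFin; first exact: nearW.
    by apply: cvg_norm; apply: cvgB => //; exact: cvg_cst.
  by rewrite is_cvg_limn_einfE ?(cvg_lim _ cvgx)//; apply/cvg_ex; eexists; exact: cvgx.
Qed.

(* Only the convergence of the integrals, not their equiabsolute continuity, is
   needed: it makes the sequence Cauchy in L1. *)
Lemma defining_sequence_lebesgue fs f l : measure_is_complete mu ->
  sigma_finite setT mu -> defining_sequence mu fs f ->
  integrals_cvg_unif mu fs l ->
  mu.-integrable setT (EFin \o f) /\
  forall A, measurable A -> (l A)%:E = (\int[mu]_(x in A) (f x)%:E)%E.
Proof.
move=> cmu sfmu [sfs cvgf _] cvgl.
have ifs n : mu.-integrable setT (EFin \o fs n) by exact: simple_function_integrable.
have mfs n : measurable_fun setT (fs n).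
  by apply/measurable_EFinP; exact: measurable_int (ifs n).
have [phi [phi_ge fsphi]] := cvg_in_measure_subseq_ae sfmu cvgf.
have mf : measurable_fun setT f.
  apply/measurable_EFinP.
  (* The limit superior of the subsequence is measurable and equals [f] almost everywhere;
     completeness carries measurability over to [f]. *)
  apply: (ae_measurable_fun cmu
    (f := fun x => limn_esup (fun k => (fs (phi k) x)%:E))); last first.
    by apply: measurable_fun_limn_esup => k; exact/measurable_EFinP.
  apply: filterS fsphi => x fsx _.
  have cvgx : (fs (phi k) x)%:E @[k --> \oo] --> (f x)%:E.
    by apply: cvg_EFin => //; exact: nearW.
  by rewrite is_cvg_limn_esupE ?(cvg_lim _ cvgx)//; apply/cvg_ex; eexists; exact: cvgx.
have cvgL1 (e : R) : 0 < e ->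
    \forall n \near \oo, (\int[mu]_x (`|fs n x - f x|)%:E <= e%:E)%E.
  (* Two errors [e / 4], one for [fs n] and one for [fs (phi k)], are doubled by
     [integral_abs_le_sup]. *)
  move=> e0; have e40 : 0 < e / 4 by rewrite divr_gt0.
  have [N _ Nl] := integrals_cvg_unif_near sfs cvgl e40.
  exists N => // n /= Nn.
  (* Almost everywhere convergence is known only along [phi]; since [k <= phi k], the index [phi k]
     also stays beyond [N]. *)
  apply: (fatou_abs_le (fs := fs \o phi)) => //=; exists N => // k /= Nk.
  rewrite (_ : e = 2 * (e / 4 + e / 4)); last by field.
  apply: (integral_abs_le_sup (h := fun x => fs n x - fs (phi k) x)).
    by apply: eq_integrable (integrableB measurableT (ifs n) (ifs (phi k))).
  move=> A mA; have iA m := integrableS measurableT mA (@subsetT _ A) (ifs m).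
  under eq_integral do rewrite EFinB.
  rewrite integralB_EFin//.
  have fin m : (\int[mu]_(x in A) (fs m x)%:E)%E \is a fin_num.
    by apply: integrable_fin_num => //; exact: iA.
  have := Nl n Nn A mA; have := Nl _ (leq_trans Nk (phi_ge k)) A mA.
  rewrite -(fineK (fin n)) -(fineK (fin (phi k))) -!EFinB !abse_EFin !lee_fin.
  move=> h1 h2; rewrite (le_trans (ler_distD (l A) _ _))// lerD//.
  by rewrite distrC.
have iB n (e : R) : (\int[mu]_x (`|fs n x - f x|)%:E <= e%:E)%E ->
    mu.-integrable setT (EFin \o (fun x => fs n x - f x)).
  move=> ne; apply/integrableP; split.
    by apply/measurable_EFinP; exact: measurable_funB.
  exact: le_lt_trans ne (ltry _).
have iF : mu.-integrable setT (EFin \o f).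
  (* One [n] at finite L1 distance from [f] suffices, because [f = fs n - (fs n - f)]. *)
  have [n _ /(_ n (leqnn n))/= /iB iBn] := cvgL1 1 ltr01.
  apply: eq_integrable (integrableB measurableT (ifs n) iBn) => //.
  by move=> x _ /=; rewrite -EFinB opprB addrC subrK.
split=> // A mA; have iA h := @integrableS _ _ _ mu _ A (EFin \o h) measurableT mA (@subsetT _ A).
have fin h : mu.-integrable setT (EFin \o h) ->
    (\int[mu]_(x in A) (h x)%:E)%E \is a fin_num.
  by move=> ih; apply: integrable_fin_num => //; exact: iA.
rewrite -(fineK (fin _ iF)); congr EFin; apply/eqP; rewrite -subr_eq0 -normr_le0.
(* Compare both sides with the integral of [fs n] over [A]: one half of [e] pays for the distance to
   [l A], the other for the L1 distance to [f]. *)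
apply/ler_addgt0Pr => e e0; rewrite add0r; have e20 : 0 < e / 2 by rewrite divr_gt0.
have [n [nl nf]] : exists n, (`|\int[mu]_(x in A) (fs n x)%:E - (l A)%:E| <= (e / 2)%:E)%E
    /\ (\int[mu]_x (`|fs n x - f x|)%:E <= (e / 2)%:E)%E.
  near \oo => n; exists n; split; last by near: n; exact: cvgL1.
  move: A mA {iA fin}; near: n; exact: integrals_cvg_unif_near.
have : (`|\int[mu]_(x in A) (fs n x)%:E - \int[mu]_(x in A) (f x)%:E| <= (e / 2)%:E)%E.
  rewrite -integralB_EFin//; [|exact: iA|exact: iA].
  have mB : measurable_fun setT (fun x => (fs n x)%:E - (f x)%:E)%E.
    by apply/measurable_EFinP; exact: measurable_funB.
  apply: le_trans (le_abse_integral _ _ _) _ => //; first exact: measurable_funTS.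
  apply: le_trans nf; apply: ge0_subset_integral => //.
  by apply/measurable_EFinP; apply: measurableT_comp => //; exact: measurable_funB.
move: nl; rewrite -(fineK (fin _ iF)) -(fineK (fin _ (ifs n))) -!EFinB !abse_EFin !lee_fin.
move=> h1 h2; rewrite [leRHS]splitr (le_trans (ler_distD _ _ _) (lerD _ h2))//.
by rewrite distrC.
Unshelve. all: by end_near. Qed.

End lebesgue_of_vitali.

(** * Nonnegative Lebesgue integrable functions are integrable *)

Section vitali_of_lebesgue.
Context (d : measure_display) (R : realType) (G : measurableType d).
Variable mu : {measure set G -> \bar R}.
Implicit Types f : G -> R.

Lemma sum_natr_le_truncn m (y : R) : 0 <= y ->
  \sum_(j < m) (j.+1%:R <= y)%R%:R = (minn m (Num.truncn y))%:R :> R.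
Proof.
move=> y0; elim: m => [|m IHm]; first by rewrite big_ord0 min0n.
rewrite big_ord_recr /= IHm -natrD -truncn_ge_nat//; congr (_%:R).
by lia.
Qed.

(* Rounding down to multiples of [1 / n.+1], truncated at height [n.+1]. *)
Definition level_approx f (n : nat) (x : G) : R :=
  \sum_(j < n.+1 * n.+1) n.+1%:R^-1 * \1_([set y | j.+1%:R / n.+1%:R <= f y]) x.

(** The sum of indicators counts the positive multiples of [1 / n.+1] not exceeding [f x], capped at
    [n.+1 * n.+1] of them. *)
Lemma level_approxE f n x : 0 <= f x ->
  level_approx f n x =
  (minn (n.+1 * n.+1) (Num.truncn (f x * n.+1%:R)))%:R / n.+1%:R.
Proof.
move=> f0; rewrite -sum_natr_le_truncn ?mulr_ge0// mulr_suml.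
apply: eq_bigr => j _; rewrite mulrC; congr (_ * _).
rewrite indicE -ler_pdivrMr//; congr (_%:R); congr nat_of_bool.
by apply/idP/idP; rewrite inE.
Qed.

Lemma level_approx_ge0 f n x : 0 <= level_approx f n x.
Proof. by apply: sumr_ge0 => j _; rewrite mulr_ge0// invr_ge0. Qed.

Lemma level_approx_le f n x : 0 <= f x -> level_approx f n x <= f x.
Proof.
move=> f0; rewrite level_approxE// ler_pdivrMr//.
apply: (@le_trans _ _ (Num.truncn (f x * n.+1%:R))%:R).
  by rewrite ler_nat geq_minr.
by rewrite truncn_le mulr_ge0.
Qed.

Lemma level_approx_le_height f n x : 0 <= f x -> level_approx f n x <= n.+1%:R.
Proof.
by move=> f0; rewrite level_approxE// ler_pdivrMr// -natrM ler_nat geq_minl.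
Qed.

(** Below height [n.+1] the cap is inactive, so only the rounding error, less than one step,
    remains. *)
Lemma level_approx_dist f n x : 0 <= f x -> f x < n.+1%:R ->
  `|level_approx f n x - f x| <= n.+1%:R^-1.
Proof.
move=> f0 fn; rewrite distrC ger0_norm ?subr_ge0 ?level_approx_le//.
rewrite level_approxE//; set t := Num.truncn _.
have tn : (t < n.+1 * n.+1)%N.
  by rewrite truncn_lt_nat ?mulr_ge0// natrM ltr_pM2r.
rewrite (minn_idPr (ltnW tn)) lerBlDr -[X in X + _]mul1r -mulrDl.
by rewrite ler_pdivlMr// nat1r; exact/ltW/truncnS_gt.
Qed.

Lemma markov_level f (e : R) : 0 < e -> (forall x, 0 <= f x) ->
  mu.-integrable setT (EFin \o f) ->
  measurable [set x | e <= f x] /\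
  (e%:E * mu [set x | (e <= f x)%R] <= \int[mu]_x (f x)%:E)%E.
Proof.
move=> e0 f0 intf; have mf := measurable_int mu intf.
split.
  rewrite (_ : mkset _ = f @^-1` `[e, +oo[); last first.
    by apply/seteqP; split=> x; rewrite /= in_itv/= andbT.
  rewrite -[X in measurable X]setTI.
  by have /measurable_EFinP := mf; apply.
have := le_integral_comp_abse mu measurableT (f := id) _ _ _ mf e0.
rewrite setTI (_ : [set x | _] = [set x | e <= f x]); last first.
  by apply/seteqP; split=> x /=; rewrite ger0_norm// lee_fin.
under eq_integral do rewrite /= ger0_norm//.
exact.
Qed.

Lemma level_set_lty f (e : R) : 0 < e -> (forall x, 0 <= f x) ->
  mu.-integrable setT (EFin \o f) -> (mu [set x | (e <= f x)%R] < +oo)%E.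
Proof.
move=> e0 f0 intf; have [_ emu] := markov_level e0 f0 intf.
(* An infinite measure would make the left side of Markov's inequality infinite, against the finite
   integral of [f]. *)
rewrite ltey; apply/eqP => muoo; move: emu; rewrite muoo gt0_muley// leye_eq.
by apply/negP; rewrite -ltey; exact: integrable_lty.
Qed.

Lemma level_approx_simple f n : (forall x, 0 <= f x) ->
  mu.-integrable setT (EFin \o f) -> simple_function mu (level_approx f n).
Proof.
move=> f0 intf; eexists; exists (fun=> n.+1%:R^-1); eexists; split=> // j.
have j0 : 0 < j.+1%:R / n.+1%:R :> R by rewrite divr_gt0.
by split; [exact: (markov_level j0 f0 intf).1|exact: level_set_lty].
Qed.

Lemma level_approx_cvg f x : 0 <= f x ->
  level_approx f n x @[n --> \oo] --> f x.
Proof.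
move=> f0; apply/cvgrPdist_le => e e0; near=> n.
rewrite distrC; apply: (le_trans (level_approx_dist f0 _)).
- apply: lt_le_trans (truncnS_gt _) _; rewrite ler_nat.
  by near: n; exists (Num.truncn (f x)).
- apply/ltW; near: n; exact: (cvgr_lt _ (@cvg_harmonic R)).
Unshelve. all: by end_near. Qed.

Lemma level_approx_eq0 f n x : 0 <= f x -> f x < n.+1%:R^-1 ->
  level_approx f n x = 0.
Proof.
move=> f0 fn; rewrite level_approxE//.
have /eqP -> : Num.truncn (f x * n.+1%:R) == 0%N.
  by rewrite -leqn0 -ltnS truncn_lt_nat ?mulr_ge0// -ltr_pdivlMr// mul1r.
by rewrite minn0 mul0r.
Qed.

Section level_approx_integrable.
Variable f : G -> R.
Hypotheses (f0 : forall x, 0 <= f x) (intf : mu.-integrable setT (EFin \o f)).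

Let mf : measurable_fun setT f.
Proof. by apply/measurable_EFinP; exact: measurable_int intf. Qed.

Let simple_g n : simple_function mu (level_approx f n).
Proof. exact: level_approx_simple. Qed.

Let mg n : measurable_fun setT (level_approx f n).
Proof.
apply/measurable_EFinP.
by apply: measurable_int (simple_function_integrable (simple_g n)).
Qed.

Let mdist n : measurable_fun setT (fun x => (`|level_approx f n x - f x|)%:E).
Proof.
by apply/measurable_EFinP; apply: measurableT_comp => //; exact: measurable_funB.
Qed.

Lemma level_approx_cvgL1 :
  (\int[mu]_x (`|level_approx f n x - f x|)%:E)%E @[n --> \oo] --> 0%E.
Proof.
have [] := @dominated_convergence _ _ _ mu setT measurableT
  (fun n x => (level_approx f n x)%:E) (EFin \o f) (EFin \o f) _ _ _ intf _ => //.
- by move=> n; exact/measurable_EFinP.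
- exact/measurable_EFinP.
- apply: aeW => x _; apply: cvg_EFin; first exact: nearW.
  exact: level_approx_cvg.
- apply: aeW => x n _ /=.
  by rewrite lee_fin ger0_norm ?level_approx_ge0// level_approx_le.
Qed.

(** The L1 distance over the whole space bounds the difference of the integrals over every [A]
    simultaneously. *)
Lemma level_approx_integrals_cvg_unif :
  integrals_cvg_unif mu (level_approx f)
    (fun A => fine (\int[mu]_(x in A) (f x)%:E)).
Proof.
apply: (cvge0_squeeze _ level_approx_cvgL1) => n; apply/andP; split.
  apply: le_trans (ereal_sup_ubound _); last by exists setT.
  by rewrite lee_fin.
apply: ge_ereal_sup => _ [A mA <-].
have iA h : mu.-integrable setT (EFin \o h) -> mu.-integrable A (EFin \o h).
  by move=> ih; exact: integrableS ih.
have ig : mu.-integrable setT (EFin \o level_approx f n).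
  exact: simple_function_integrable.
rewrite -abse_EFin EFinB simple_integral_lebesgue// fineK; last first.
  by apply: integrable_fin_num => //; exact: iA.
rewrite -integralB_EFin//; [|exact: iA|exact: iA].
apply: le_trans (le_abse_integral _ _ _) _ => //.
  apply: measurable_funTS.
  by apply/measurable_EFinP; exact: measurable_funB.
by apply: (ge0_subset_integral mu mA measurableT (mdist n)).
Qed.

Lemma level_approx_cvg_in_measure A : measurable A ->
  cvg_in_measure_on mu A (level_approx f) f.
Proof.
move=> mA; pose L n := [set x | n.+1%:R <= f x].
have mL n : measurable (L n) by apply: (markov_level _ f0 intf).1.
exists L; split => //.
- apply: cvge0_near_le => // e e0.
  have If : (\int[mu]_x (f x)%:E)%E \is a fin_num by exact: integrable_fin_num.
  near=> n; apply: (@le_trans _ _ (mu (L n))).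
    by apply: le_measure; rewrite ?inE//; exact: measurableI.
  (* Markov's inequality gives the bound [e] as soon as [n.+1] exceeds the integral of [f] divided
     by [e]. *)
  have [_ Ln] := markov_level (ltr0Sn R n) f0 intf.
  rewrite -(@lee_pmul2l _ n.+1%:R%:E)//; apply: le_trans Ln _.
  rewrite -(fineK If) -EFinM lee_fin -ler_pdivrMr//.
  apply: le_trans (ltW (truncnS_gt _)) _; rewrite ler_nat ltnS.
  by near: n; exact: nbhs_infty_ge.
- apply: (cvge0_squeeze _ (@cvge_harmonic R)) => n; apply/andP; split.
    by apply: ereal_sup_ubound; left.
  apply: ge_ereal_sup => _ [->|[x [_ /negP fn] <-]].
    by rewrite lee_fin; exact: harmonic_ge0.
  by move: fn; rewrite -ltNge lee_fin; exact: level_approx_dist.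
Unshelve. all: by end_near. Qed.

Let simple_integral_norm A n : measurable A ->
  (simple_integral mu A (fun x => `|level_approx f n x|))%:E =
  (\int[mu]_(x in A) (level_approx f n x)%:E)%E.
Proof.
move=> mA; rewrite -simple_integral_lebesgue//; congr (simple_integral _ _ _)%:E.
by apply/funext => x; rewrite ger0_norm// level_approx_ge0.
Qed.

Let integral_level_approx_le A n : measurable A ->
  (\int[mu]_(x in A) (level_approx f n x)%:E <= \int[mu]_(x in A) (f x)%:E)%E.
Proof.
move=> mA; apply: ge0_le_integral => //.
- by move=> x _; rewrite lee_fin level_approx_ge0.
- by apply: measurable_funTS; exact/measurable_EFinP.
- by apply: measurable_funTS; exact/measurable_EFinP.
- by move=> x _; rewrite lee_fin level_approx_le.
Qed.

(** Absolute continuity of the integral in quantitative form: [f] is at most its distance to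
    [level_approx f k] plus that approximation, whose height is at most [k.+1]. *)
Let integral_le_dist_height A k : measurable A ->
  (\int[mu]_(x in A) (f x)%:E <=
   \int[mu]_x (`|level_approx f k x - f x|)%:E + k.+1%:R%:E * mu A)%E.
Proof.
move=> mA; rewrite -integral_cst//.
apply: (@le_trans _ _ (\int[mu]_(x in A)
    ((`|level_approx f k x - f x|)%:E + k.+1%:R%:E))%E).
  apply: ge0_le_integral => //.
  - by move=> x _; rewrite lee_fin.
  - by apply: measurable_funTS; exact/measurable_EFinP.
  - by apply: emeasurable_funD => //; exact: measurable_funTS.
  - move=> x _; rewrite -EFinD lee_fin.
    rewrite -{1}(subrK (level_approx f k x) (f x)) lerD//.
      by rewrite distrC ler_norm.
    exact: level_approx_le_height.
rewrite ge0_integralD//; last exact: measurable_funTS.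
by rewrite leeD2r//; apply: (ge0_subset_integral mu mA measurableT (mdist k)).
Qed.

Lemma level_approx_equi_abs_continuous :
  equi_abs_continuous mu (level_approx f).
Proof.
split.
- move=> A mA muA0.
  suff : (simple_integral mu (A n) (fun x => `|level_approx f n x|))%:E
      @[n --> \oo] --> 0%E by move/fine_cvg.
  apply: cvge0_near_le.
    move=> n; rewrite simple_integral_norm//; apply: integral_ge0 => x _.
    by rewrite lee_fin level_approx_ge0.
  move=> e e0; have e20 : 0 < e / 2 by rewrite divr_gt0.
  (* First fix [k] with L1 distance below [e / 2]; the height [k.+1] then dictates how small
     [mu (A n)] must be. *)
  have [k _ /(_ k (leqnn k))/= /ltW kf] := cvge0_near_lt level_approx_cvgL1 e20.
  have ek0 : 0 < e / 2 / k.+1%:R by rewrite divr_gt0.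
  apply: filterS (cvge0_near_lt muA0 ek0) => n /ltW Anek.
  rewrite simple_integral_norm//; apply: le_trans (integral_level_approx_le _ _) _ => //.
  apply: le_trans (integral_le_dist_height k _) _ => //.
  rewrite (splitr e) EFinD leeD//.
  apply: (le_trans (lee_wpmul2l _ Anek)) => //.
  by rewrite -EFinM mulrC divfK.
(* Off [B m] the approximation [level_approx f m] vanishes, so there [f] equals its distance to it.
   As every [level_approx f n] lies below [f], the L1 distance at [m] bounds the tails for all
   [n]. *)
- pose B m := [set x | m.+1%:R^-1 <= f x].
  have Bm0 m : 0 < m.+1%:R^-1 :> R by rewrite invr_gt0.
  have mB m : measurable (B m) by exact: (markov_level (Bm0 m) f0 intf).1.
  exists B; split.
  + by move=> m; split => //; exact: level_set_lty.
  + move=> m n mn x; apply: le_trans.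
    by rewrite lef_pV2 ?posrE// ler_nat.
  + apply: (cvge0_squeeze _ level_approx_cvgL1) => m.
    rewrite limn_esup_lim; apply/andP; split.
      apply: lime_ge; first exact: is_cvg_esups.
      apply: nearW => n; apply: le_trans (ereal_sup_ubound _); last by exists n => /=.
      rewrite simple_integral_norm; last exact: measurableC.
      by apply: integral_ge0 => x _; rewrite lee_fin level_approx_ge0.
    apply: lime_le; first exact: is_cvg_esups.
    apply: nearW => n; apply: ge_ereal_sup => _ [i _ <-].
    rewrite simple_integral_norm; last exact: measurableC.
    apply: le_trans (integral_level_approx_le _ _) _; first exact: measurableC.
    rewrite (eq_integral (fun x => (`|level_approx f m x - f x|)%:E)).
      apply: (ge0_subset_integral mu _ measurableT (mdist m)) => //.
      exact: measurableC.
    move=> x; rewrite inE /B/= => /negP; rewrite -ltNge => fx.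
    by rewrite level_approx_eq0// sub0r normrN ger0_norm.
Qed.

Lemma level_approx_defining : defining_sequence mu (level_approx f) f.
Proof.
split=> //; last exact: level_approx_equi_abs_continuous.
by move=> A mA _; exact: level_approx_cvg_in_measure.
Qed.

End level_approx_integrable.

End vitali_of_lebesgue.

(** * The equivalence for nonnegative functions, then for signed ones *)

Section nonneg_vitali.
Context (d : measure_display) (R : realType) (G : measurableType d).
Variable mu : {measure set G -> \bar R}.
Hypotheses (cmu : measure_is_complete mu) (sfmu : sigma_finite setT mu).
Implicit Types f : G -> R.

Lemma nonneg_vitali_integrableP f : (forall x, 0 <= f x) ->
  nonneg_vitali_integrable mu f <-> mu.-integrable setT (EFin \o f).
Proof.
move=> f0; split=> [[_ [fs [l [fsf cvgl]]]]|intf].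
  by have [] := defining_sequence_lebesgue cmu sfmu fsf cvgl.
split=> //; exists (level_approx f); eexists; split.
- exact: level_approx_defining.
- exact: level_approx_integrals_cvg_unif.
Qed.

(** Whichever sequence and [l] the choice operator selects, [l] agrees with the Lebesgue integral on
    measurable sets. *)
Lemma nonneg_vitali_integralE A f : measurable A ->
  nonneg_vitali_integrable mu f ->
  (nonneg_vitali_integral mu A f)%:E = (\int[mu]_(x in A) (f x)%:E)%E.
Proof.
move=> mA [_ [fs [l [fsf cvgl]]]]; rewrite /nonneg_vitali_integral.
case: xgetP => [v _ [fs' [l' [fsf' cvgl' ->]]]|/(_ (l A)) []].
  by have [_ ->] := defining_sequence_lebesgue cmu sfmu fsf' cvgl'.
by exists fs, l.
Qed.

End nonneg_vitali.

Theorem proposition3p15 (d : measure_display) (R : realType)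
    (G : measurableMetricType d R) (mu : {measure set G -> \bar R})
    (open_measurable : forall U : set G, open U -> measurable U)
    (mu_complete : measure_is_complete mu)
    (mu_sigma_finite : sigma_finite setT mu)
    (mu_regular : regular_measure mu)
    (f : G -> R) :
  (vitali_integrable mu f <-> mu.-integrable setT (EFin \o f)) /\
  (vitali_integrable mu f -> forall A : set G, measurable A ->
     (vitali_integral mu A f)%:E = (\int[mu]_(g in A) (f g)%:E)%E).
Proof.
split.
- rewrite /vitali_integrable !nonneg_vitali_integrableP//; split=> [[fp fn]|intf].
    (* Recover [f] as the difference of its positive and negative parts. *)
    apply: eq_integrable (integrableB measurableT fp fn) => // x _ /=.
    by rewrite -EFinB -[in RHS](funrposBneg f).
  by split; [exact: integrable_funrpos|exact: integrable_funrneg].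
- move=> [vp vn] A mA.
  rewrite /vitali_integral EFinB !nonneg_vitali_integralE// [RHS]integralE.
  by rewrite -/(EFin \o f) funerpos funerneg.
Qed.
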